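(* Suppose that the standing assumptions (i)–(iii) of the context hold and that $\theta>\theta_{\min}$. Fix $z\in\mathcal Z$. Then the robust conditional chance constraint $$\sup_{\mathbb P\in\mathcal P_{\theta,\varepsilon}(\mathcal N)}\mathbb P\left[Y\notin\mathcal S(z)\mid X\in\mathcal N\right]\le\epsilon$$ holds if and only if there exist $t\ge0$, $v_i\ge0$ and $s_i\in\mathbb R$ for $i\in[N]$, and $\lambda\in\mathbb R$ such that $$\begin{aligned}&K_0+\epsilon\varepsilon t-\varepsilon\lambda-\frac1N\sum_{i\in[N]}v_i\ge\theta,\\&v_i+\lambda\ge s_i&&\forall i\in[N],\\&\Delta_i(z)+\bar\kappa_i\ge t-s_i&&\forall i\in[N],\\&s_i\ge-\bar\kappa_i&&\forall i\in[N],\\&\lambda\le\epsilon t.\end{aligned}$$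
   Context: $[N]=\{1,\dots,N\}$. Two distinct symbols are used: $\varepsilon\in(0,1]$ is a lower bound on the probability of the conditioning event, and $\epsilon\in(0,1)$ is the risk limit. $\mathcal X$ is the context space and $\mathcal Y$ the outcome space, with metrics $d_{\mathcal X},d_{\mathcal Y}$; $X,Y$ denote the two coordinates. $\mathcal Z\subseteq\mathbb R^{\dim(z)}$ is the decision set; for each $z\in\mathcal Z$, $\mathcal S(z)\subseteq\mathcal Y$ is the safety set and $\mathcal S^c(z)=\mathcal Y\setminus\mathcal S(z)$ the failure set. Given samples $(\hat x_i,\hat y_i)\in\mathcal X\times\mathcal Y$, $i\in[N]$, let $\widehat{\mathbb P}_N=\frac1N\sum_{i}\delta_{(\hat x_i,\hat y_i)}$. $W$ is the type-1 Wasserstein distance on probability distributions on $\mathcal X\times\mathcal Y$ with ground metric $d_{\mathcal X}(x,x')+d_{\mathcal Y}(y,y')$. $x_0\in\mathcal X$ is a target context, $\gamma\ge0$, and $\mathcal N=\mathcal N_\gamma(x_0)\subseteq\mathcal X$ is a neighborhood with $x_0\in\mathcal N$, $\sup_{x\in\mathcal N}d_{\mathcal X}(x,x_0)\le\gamma$, and $\mathcal N_0(x_0)=\{x_0\}$. With $\theta>0$ and $\mathbb P_X$ the $\mathcal X$-marginal of $\mathbb P$, $$\mathcal P_{\theta,\varepsilon}(\mathcal N)=\{\mathbb P: W(\mathbb P,\widehat{\mathbb P}_N)\le\theta,\ \mathbb P_X(\mathcal N)\ge\varepsilon\}.$$ Standing assumptions: (i) $(\mathcal X,d_{\mathcal X})$,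 $(\mathcal Y,d_{\mathcal Y})$ are Polish metric spaces with their Borel $\sigma$-fields, and transport is allowed on all of $\mathcal X\times\mathcal Y$; (ii) $\mathcal N$ is Borel and the distances from each $\hat x_i$ to $\mathcal N$ and to $\mathcal N^c$ are finite; (iii) for every $z\in\mathcal Z$, $\mathcal S^c(z)$ is a nonempty Borel set and the distance from each $\hat y_i$ to it is finite. Define $\kappa_i^{\rm in}=\inf_{x\in\mathcal N}d_{\mathcal X}(\hat x_i,x)$, $\kappa_i^{\rm out}=\inf_{x\in\mathcal N^c}d_{\mathcal X}(\hat x_i,x)$, $\bar\kappa_i=\kappa_i^{\rm in}-\kappa_i^{\rm out}$, $K_0=\frac1N\sum_i\kappa_i^{\rm out}$, $\Delta_i(z)=\inf_{y\in\mathcal S^c(z)}d_{\mathcal Y}(\hat y_i,y)$, and $\theta_{\min}=\inf\{W(\mathbb P,\widehat{\mathbb P}_N): \mathbb P_X(\mathcal N)\ge\varepsilon\}$. *)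

(* Defs.v *)
From HB Require Import structures.
From mathcomp Require Import all_boot all_order all_algebra.
From mathcomp Require Import all_classical all_reals all_analysis.

Set Implicit Arguments.
Unset Strict Implicit.
Unset Printing Implicit Defensive.

Import Order.TTheory GRing.Theory Num.Theory.
Import numFieldNormedType.Exports.

Local Open Scope classical_set_scope.
Local Open Scope ring_scope.

HB.mixin Record isSeparableBorel (d : measure_display) T
    & Topological T & Measurable d T := {
  separable_subproof : exists2 D : set T, countable D & dense D ;
  measurable_borel_subproof : @measurable d T = <<s (@open T) >>
}.

(* A complete separable metric space with its Borel sigma-field. The library's
   completeType and measurableType are pointed, so the space is nonempty.
   Products are taken in measurableType: by separability the product
   sigma-field of two such spaces is the Borel one. *)
#[short(type="polishMetricType")]
HB.structure Definition PolishMetric (R : numDomainType) (d : measure_display) :=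
  {T of Metric R T & Complete T & Measurable d T & isSeparableBorel d T}.

Section empirical.
Local Open Scope ereal_scope.
Context {d : measure_display} {T : measurableType d} {R : realType}.
Variables (N : nat) (s : 'I_N -> T).

Definition empirical (A : set T) : \bar R :=
  (N%:R^-1)%:E * \sum_(i < N) \d_(s i) A.

Let empirical0 : empirical set0 = 0.
Proof. by rewrite /empirical big1 ?mule0// => i _; rewrite measure0. Qed.

Let empirical_ge0 A : 0 <= empirical A.
Proof.
rewrite /empirical mule_ge0// ?lee_fin ?invr_ge0//.
by apply: sume_ge0 => i _.
Qed.

Let empirical_sigma_additive : semi_sigma_additive empirical.
Proof.
move=> F mF tF mUF; rewrite /empirical.
rewrite [X in X @ \oo --> _](_ : _ = (fun n => (N%:R^-1)%:E *
    \sum_(0 <= k < n) \sum_(i < N) \d_(s i) (F k))); last first.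
  apply/funext => n; rewrite ge0_sume_distrr// => k _.
  by apply: sume_ge0 => i _.
apply: cvgeZl => //.
under eq_fun do rewrite exchange_big/=.
apply: cvg_nnesum => i _; last exact: measure_semi_sigma_additive.
by near=> n; apply: sume_ge0.
Unshelve. all: by end_near. Qed.

HB.instance Definition _ := isMeasure.Build _ _ _ empirical
  empirical0 empirical_ge0 empirical_sigma_additive.

Lemma empirical_setT : (0 < N)%N -> empirical setT = 1.
Proof.
move=> N0; rewrite /empirical (eq_bigr (fun=> 1)); last first.
  by move=> i _; rewrite diracT.
by rewrite sumEFin sumr_const card_ord -EFinM mulVf// pnatr_eq0 -lt0n.
Qed.

End empirical.
Arguments empirical {d T R N} s A.

Section wasserstein.
Local Open Scope ereal_scope.
Context {d : measure_display} {T : measurableType d} {R : realType}.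

Definition coupling (mu nu : {measure set T -> \bar R}) :
    set (probability (T * T)%type R) :=
  [set pi | forall A : set T, measurable A ->
     pushforward pi fst A = mu A /\ pushforward pi snd A = nu A].

Definition wasserstein (c : T -> T -> R)
    (mu nu : {measure set T -> \bar R}) : \bar R :=
  ereal_inf [set \int[pi]_u (c u.1 u.2)%:E | pi in coupling mu nu].

(* Only meaningful when P B != 0. *)
Definition cond_prob (P : probability T R) (A B : set T) : \bar R :=
  P (A `&` B) / P B.

End wasserstein.

(* The infimum lives in \bar R: it is +oo when A is empty. *)
Definition dist_to_set {R : realType} {T : metricType R} (x : T) (A : set T) :
    \bar R :=
  ereal_inf [set (mdist x a)%:E | a in A].

Definition is_neighborhood {R : realType} {X : metricType R}
    (x0 : X) (gamma : R) (Nb : set X) : Prop :=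
  [/\ Nb x0,
      (ereal_sup [set (mdist x x0)%:E | x in Nb] <= gamma%:E)%E &
      gamma = 0 -> Nb = [set x0]].

Section ambiguity.
Local Open Scope ereal_scope.
Context {R : realType} {dX dY : measure_display}.
Context {X : polishMetricType R dX} {Y : polishMetricType R dY}.
Variables (N : nat) (xhat : 'I_N -> X) (yhat : 'I_N -> Y).

Definition ground_metric (p q : X * Y) : R :=
  (mdist p.1 q.1 + mdist p.2 q.2)%R.

Definition W_to_empirical (P : probability (X * Y)%type R) : \bar R :=
  wasserstein ground_metric P (empirical (fun i => (xhat i, yhat i))).

Definition X_marginal (P : probability (X * Y)%type R) : set X -> \bar R :=
  pushforward P fst.

Definition ambiguity_set (theta eps : R) (Nb : set X) :
    set (probability (X * Y)%type R) :=
  [set P | W_to_empirical P <= theta%:E /\ eps%:E <= X_marginal P Nb].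

Definition theta_min (eps : R) (Nb : set X) : \bar R :=
  ereal_inf [set W_to_empirical P |
    P in [set P : probability (X * Y)%type R | eps%:E <= X_marginal P Nb]].

Definition worst_case_cond_prob (theta eps : R) (Nb : set X) (F : set Y) :
    \bar R :=
  ereal_sup [set cond_prob P (snd @^-1` F) (fst @^-1` Nb) |
    P in ambiguity_set theta eps Nb].

Definition kappa_in (Nb : set X) (i : 'I_N) : R :=
  fine (dist_to_set (xhat i) Nb).

Definition kappa_out (Nb : set X) (i : 'I_N) : R :=
  fine (dist_to_set (xhat i) (~` Nb)).

Definition kappa_bar (Nb : set X) (i : 'I_N) : R :=
  (kappa_in Nb i - kappa_out Nb i)%R.

Definition K0 (Nb : set X) : R :=
  (N%:R^-1 * \sum_(i < N) kappa_out Nb i)%R.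

Definition Delta (F : set Y) (i : 'I_N) : R :=
  fine (dist_to_set (yhat i) F).

End ambiguity.

(* Main.v *)
Require Import Defs.
From HB Require Import structures.
From mathcomp Require Import all_boot all_order all_algebra.
From mathcomp Require Import all_classical all_reals all_analysis.
From mathcomp Require Import measurable_realfun ring lra.

Set Implicit Arguments.
Unset Strict Implicit.
Unset Printing Implicit Defensive.

Import Order.TTheory GRing.Theory Num.Theory.
Import numFieldNormedType.Exports.

Local Open Scope classical_set_scope.
Local Open Scope ring_scope.

(** Fix a decision and let [F] be its failure set. A distribution near the
    empirical one is described, up to arbitrarily small cost, by how each
    sample splits its mass [1/N]: a part [al i] goes to the failure set above
    the neighborhood at unit cost [kappa_in i + Delta i], a part [be i] goes to
    the neighborhood at unit cost [kappa_in i], and the rest leaves the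
    neighborhood at unit cost [kappa_out i]. The chance constraint then says,
    roughly, that every split which gives the neighborhood mass at least [eps]
    and reaches the risk level costs at least [theta]. This is a statement about
    the value of a finite linear program, and the finite system of the theorem
    is its dual, with [s i] standing for an intermediate bound between
    [v i + lambda] and the two lower bounds that it must satisfy.

    If the chance constraint holds, every admissible split costs at least
    [theta] ([plans_cost_ge]), since a cheaper one can be made to violate the
    risk bound strictly and realized by a finitely supported coupling
    ([realize_transport_plan]). Strong duality ([transport_lp_duality], from
    [farkas]) then produces the multipliers.

    Conversely, a dual solution bounds the transport cost of every distribution
    [P] from below by an affine function of the probabilities under [P] of the
    conditioning event and of the failure event ([W_to_empirical_ge], from
    [kantorovich_weak_duality]). If [P] gives the neighborhood mass at least
    [eps] and violates the risk bound strictly, this function exceeds [theta]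
    as soon as [t > 0], so [P] is not in the ambiguity set. The case [t = 0] is
    excluded by the assumption on [theta_min]. *)

(** * Farkas' lemma and linear programming duality *)

Lemma sum_enum_val (V : nmodType) (J : finType) (F : J -> V) :
  \sum_(i < #|J|) F (enum_val i) = \sum_j F j.
Proof.
rewrite [RHS](reindex (@enum_val J J))//=.
by exists enum_rank => j _; rewrite ?enum_valK ?enum_rankK.
Qed.

(** Bartl's algebraic induction on the number of functionals. If the last functional is
    indispensable, some [y] satisfies all other inequalities but not the
    conclusion, so the last functional is negative at [y]; projecting along
    [y] onto its kernel eliminates it, and its multiplier is recovered as the
    value that makes the identity hold at [y]. *)
Lemma farkas_ord (R : realFieldType) (V : lmodType R) (m : nat)
    (A : 'I_m -> V -> R) (b : V -> R) :
  (forall i, linear_for *%R (A i)) -> linear_for *%R b ->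
  (forall x, (forall i, 0 <= A i x) -> 0 <= b x) ->
  exists u : 'I_m -> R,
    (forall i, 0 <= u i) /\ forall x, b x = \sum_i u i * A i x.
Proof.
elim: m A b => [|m IH] A b linA linb Ab.
  (* Without constraints, [b] is nonnegative at both [x] and [- x]. *)
  exists (fun=> 0); split=> // x; rewrite big_ord0.
  have linN y : b (- y) = - b y.
    have b0 : b 0 = 0.
      by have := linb 1 0 0; rewrite scaler0 addr0 mul1r => /eqP;
        rewrite -subr_eq0 opprD addNKr oppr_eq0 => /eqP.
    by have := linb (-1) y 0; rewrite scaleN1r addr0 b0 mulN1r addr0.
  apply/eqP; rewrite eq_le; apply/andP; split; last by apply: Ab; case.
  by rewrite -oppr_ge0 -linN; apply: Ab; case.
have widE (i : 'I_m) : widen_ord (leqnSn m) i = lift ord_max i.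
  by apply: val_inj; rewrite /= /bump leqNgt ltn_ord.
pose Al := A ord_max; pose A0 i := A (widen_ord (leqnSn m) i).
have [Hb|] := pselect (forall x, (forall i, 0 <= A0 i x) -> 0 <= b x).
  have [u [u0 bE]] := IH A0 b (fun i => linA _) linb Hb.
  exists (fun i => if unlift ord_max i is Some j then u j else 0); split.
    by move=> i; case: unlift.
  move=> x; rewrite bE big_ord_recr/= unlift_none mul0r addr0.
  apply: eq_bigr => i _.
  by rewrite /A0 widE liftK.
move=> /existsNP[y] /not_implyP[Ay] /negP; rewrite -ltNge => by0.
have Aly : Al y < 0.
  rewrite ltNge; apply/negP => Aly; move: by0; rewrite ltNge => /negP; apply.
  apply: Ab => i; have [j ->|->] := unliftP ord_max i => //.
  by rewrite -widE; exact: Ay.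
have Aly0 : Al y != 0 by rewrite lt_eqF.
pose p x := x - (Al x / Al y) *: y.
pose proj (f : V -> R) x := f x - Al x / Al y * f y.
have projE f x : linear_for *%R f -> f (p x) = proj f x.
  by move=> linf; rewrite /p addrC -scaleNr linf /proj mulNr addrC.
have linproj f : linear_for *%R f -> linear_for *%R (proj f).
  move=> linf a u v; rewrite /proj linf [Al _]linA /Al; ring.
have [x Hx|u [u0 bE]] := IH (fun i => proj (A0 i)) (proj b)
    (fun i => linproj _ (linA _)) (linproj _ linb).
  rewrite -projE //; apply: Ab => i; have [j ->|->] := unliftP ord_max i.
    by rewrite -widE projE; [exact: Hx|exact: linA].
  by rewrite projE; [rewrite /proj divfK// subrr|exact: linA].
(* Numerator and denominator are both nonpositive. *)
pose c := (b y - \sum_i u i * A0 i y) / Al y.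
exists (fun i => if unlift ord_max i is Some j then u j else c); split.
  move=> i; case: unlift => [//|]; rewrite /c ler_ndivlMr// mul0r subr_le0.
  by apply: (le_trans (ltW by0)); apply: sumr_ge0 => i' _; rewrite mulr_ge0.
move=> x; rewrite big_ord_recr/= unlift_none.
have := bE x; rewrite {1}/proj => /eqP; rewrite subr_eq => /eqP ->.
rewrite (eq_bigr (fun i => u i * A0 i x - Al x / Al y * (u i * A0 i y))); last first.
  by move=> i _; rewrite /proj; ring.
rewrite sumrB -mulr_sumr -/Al.
rewrite [in RHS](eq_bigr (fun i => u i * A0 i x)); last first.
  by move=> i _; rewrite /A0 widE liftK.
rewrite /c; field.
exact: Aly0.
Qed.

Lemma farkas (R : realFieldType) (V : lmodType R) (J : finType)
    (A : J -> V -> R) (b : V -> R) :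
  (forall j, linear_for *%R (A j)) -> linear_for *%R b ->
  (forall x, (forall j, 0 <= A j x) -> 0 <= b x) ->
  exists u : J -> R,
    (forall j, 0 <= u j) /\ forall x, b x = \sum_j u j * A j x.
Proof.
move=> linA linb Ab.
have [x Hx|u [u0 bE]] :=
    @farkas_ord R V #|J| (fun i => A (enum_val i)) b (fun=> linA _) linb.
  by apply: Ab => j; have := Hx (enum_rank j); rewrite enum_rankK.
exists (fun j => u (enum_rank j)); split=> // x; rewrite bE -[RHS]sum_enum_val.
by apply: eq_bigr => i _; rewrite enum_valK.
Qed.

(** Strong duality for the linear program whose variables are the masses
    [al i] and [be i] sent from the [i]-th sample to the failure part of the
    neighborhood and to the rest of it; [a] and [b] are the unit costs relative
    to leaving the neighborhood. The multipliers [t], [mu] and [v i] belong to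
    the violated risk bound, the lower bound on the total mass and the capacity
    of the [i]-th sample. The program is inhomogeneous, so Farkas' lemma is
    applied to its homogenization with a scaling variable, the third component
    of the space [V]. *)
Lemma transport_lp_duality (R : realFieldType) (N : nat) (a b : 'I_N -> R)
    (k eps risk theta : R) : (0 < N)%N ->
  (forall al be : 'I_N -> R, (forall i, 0 <= al i) -> (forall i, 0 <= be i) ->
     (forall i, al i + be i <= N%:R^-1) ->
     eps <= \sum_i (al i + be i) ->
     risk * \sum_i (al i + be i) <= \sum_i al i ->
     theta <= k + \sum_i (al i * a i + be i * b i)) ->
  exists (t mu : R) (v : 'I_N -> R),
    [/\ 0 <= t, 0 <= mu & forall i, 0 <= v i] /\
    [/\ forall i, (1 - risk) * t + mu - v i <= a i,
        forall i, mu - risk * t - v i <= b i &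
        theta <= k + eps * mu - N%:R^-1 * \sum_i v i].
Proof.
move=> N0 Hlp.
have NR0 : 0 < N%:R :> R by rewrite ltr0n.
pose V := ('rV[R]_N * 'rV[R]_N * R^o)%type.
pose mass (x : V) := \sum_i (x.1.1 0 i + x.1.2 0 i).
pose A (j : 'I_N + 'I_N + 'I_N + bool) (x : V) : R :=
  match j with
  | inl (inl (inl i)) => x.1.1 0 i
  | inl (inl (inr i)) => x.1.2 0 i
  | inl (inr i) => x.2 / N%:R - (x.1.1 0 i + x.1.2 0 i)
  | inr true => \sum_i x.1.1 0 i - risk * mass x
  | inr false => mass x - eps * x.2
  end.
pose c (x : V) : R :=
  (k - theta) * x.2 + \sum_i (x.1.1 0 i * a i + x.1.2 0 i * b i).
have lin_mass : linear_for *%R mass.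
  move=> l x y; rewrite /mass mulr_sumr -big_split; apply: eq_bigr => i _ /=.
  by rewrite !mxE; ring.
have linA j : linear_for *%R (A j).
  case: j => [[[i|i]|i]|[]] l x y /=; rewrite ?mxE ?lin_mass//.
  - by rewrite /GRing.scale/=; ring.
  - rewrite (eq_bigr (fun i => l * x.1.1 0 i + y.1.1 0 i)); last first.
      by move=> i _; rewrite !mxE.
    by rewrite big_split -mulr_sumr/=; ring.
  - by rewrite /GRing.scale/=; ring.
have linc : linear_for *%R c.
  move=> l x y; rewrite /c/=.
  rewrite (eq_bigr (fun i => l * (x.1.1 0 i * a i + x.1.2 0 i * b i) +
      (y.1.1 0 i * a i + y.1.2 0 i * b i))); last first.
    by move=> i _; rewrite !mxE; ring.
  by rewrite big_split -mulr_sumr/= /GRing.scale/=; ring.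
have Ac x : (forall j, 0 <= A j x) -> 0 <= c x.
  case: x => [[al be] tau] Ax.
  have al0 i : 0 <= al 0 i := Ax (inl (inl (inl i))).
  have be0 i : 0 <= be 0 i := Ax (inl (inl (inr i))).
  have abt i : al 0 i + be 0 i <= tau / N%:R.
    by have := Ax (inl (inr i)); rewrite /= subr_ge0.
  have tau0 : 0 <= tau.
    have := le_trans (addr_ge0 (al0 (Ordinal N0)) (be0 (Ordinal N0))) (abt _).
    by rewrite pmulr_lge0 ?invr_gt0.
  (* At scale zero the capacities vanish, hence so does the whole plan;
     otherwise dividing by the scale gives a feasible plan. *)
  move: tau0; rewrite le_eqVlt => /predU1P[tau0|tau0].
    rewrite /c/= -tau0 mulr0 add0r big1// => i _.
    have := abt i; rewrite -tau0 mul0r => ab0.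
    have -> : al 0 i = 0 by have := al0 i; have := be0 i; lra.
    have -> : be 0 i = 0 by have := al0 i; have := be0 i; lra.
    by rewrite !mul0r addr0.
  have massE : \sum_i (al 0 i / tau + be 0 i / tau) = mass (al, be, tau) / tau.
    by rewrite /mass mulr_suml; apply: eq_bigr => i _; rewrite mulrDl.
  have alE : \sum_i (al 0 i / tau) = (\sum_i al 0 i) / tau by rewrite mulr_suml.
  have := Hlp (fun i => al 0 i / tau) (fun i => be 0 i / tau).
  rewrite massE alE.
  have -> : \sum_i (al 0 i / tau * a i + be 0 i / tau * b i) =
      (\sum_i (al 0 i * a i + be 0 i * b i)) / tau.
    by rewrite mulr_suml; apply: eq_bigr => i _; ring.
  move=> H; have {}H : theta <= k + (\sum_i (al 0 i * a i + be 0 i * b i)) / tau.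
    apply: H.
    - by move=> i; rewrite divr_ge0// ltW.
    - by move=> i; rewrite divr_ge0// ltW.
    - by move=> i; rewrite -mulrDl ler_pdivrMr// mulrC.
    - by rewrite ler_pdivlMr//; have := Ax (inr false); rewrite /= subr_ge0.
    - rewrite mulrA ler_pM2r ?invr_gt0//.
      by have := Ax (inr true); rewrite /= subr_ge0.
  move: H; rewrite -lerBlDl ler_pdivlMr// /c/= => H.
  by rewrite -[k - theta]opprB mulNr addrC subr_ge0.
have [u [u0 cE]] := farkas linA linc Ac.
pose v i := u (inl (inr i)).
pose t := u (inr true); pose mu := u (inr false).
have {cE}cE x : c x = \sum_i (u (inl (inl (inl i))) * x.1.1 0 i)
    + \sum_i (u (inl (inl (inr i))) * x.1.2 0 i)
    + \sum_i v i * (x.2 / N%:R - (x.1.1 0 i + x.1.2 0 i))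
    + (t * (\sum_i x.1.1 0 i - risk * mass x) + mu * (mass x - eps * x.2)).
  by rewrite cE !big_sumType/= big_bool/=.
(* The identity between linear functionals, coefficient by coefficient:
   [ra], [rb] and [r] are the coefficients of the difference of its sides. *)
pose ra i := a i - (u (inl (inl (inl i))) + ((1 - risk) * t + mu - v i)).
pose rb i := b i - (u (inl (inl (inr i))) + (mu - risk * t - v i)).
pose r := k - theta - (N%:R^-1 * (\sum_i v i) - eps * mu).
have rE (x : V) : \sum_i ra i * x.1.1 0 i + \sum_i rb i * x.1.2 0 i + r * x.2 = 0.
  have := cE x; rewrite /c /mass => {}cE.
  have vE : \sum_i v i * (x.2 / N%:R - (x.1.1 0 i + x.1.2 0 i)) =
      (\sum_i v i) * (x.2 / N%:R) - \sum_i v i * x.1.1 0 i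
      - \sum_i v i * x.1.2 0 i.
    rewrite mulr_suml -!sumrB; apply: eq_bigr => i _; ring.
  rewrite vE !big_split/= in cE.
  have raE : \sum_i ra i * x.1.1 0 i = \sum_i x.1.1 0 i * a i
      - \sum_i u (inl (inl (inl i))) * x.1.1 0 i
      - ((1 - risk) * t + mu) * \sum_i x.1.1 0 i + \sum_i v i * x.1.1 0 i.
    rewrite mulr_sumr -!sumrB -big_split; apply: eq_bigr => i _ /=.
    rewrite /ra; ring.
  have rbE : \sum_i rb i * x.1.2 0 i = \sum_i x.1.2 0 i * b i
      - \sum_i u (inl (inl (inr i))) * x.1.2 0 i
      - (mu - risk * t) * \sum_i x.1.2 0 i + \sum_i v i * x.1.2 0 i.
    rewrite mulr_sumr -!sumrB -big_split; apply: eq_bigr => i _ /=.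
    rewrite /rb; ring.
  rewrite raE rbE /r; move/eqP: cE; rewrite -subr_eq0 => /eqP cE.
  rewrite -[RHS]cE; ring.
have sum_delta (f : 'I_N -> R) i :
    \sum_j f j * (delta_mx 0 i : 'rV[R]_N) 0 j = f i.
  rewrite (bigD1 i)//= !mxE !eqxx mulr1 big1 ?addr0// => j /negbTE ji.
  by rewrite mxE ji andbF mulr0.
have sum_zero (f : 'I_N -> R) : \sum_j f j * (0 : 'rV[R]_N) 0 j = 0.
  by apply: big1 => j _; rewrite mxE mulr0.
exists t, mu, v; split; split; rewrite ?u0//.
- by move=> i; exact: u0.
- move=> i; have := rE (delta_mx 0 i, 0, 0).
  rewrite /= sum_delta sum_zero mulr0 !addr0 /ra => /eqP.
  by rewrite subr_eq0 => /eqP ->; rewrite lerDr.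
- move=> i; have := rE (0, delta_mx 0 i, 0).
  rewrite /= sum_delta sum_zero mulr0 add0r addr0 /rb => /eqP.
  by rewrite subr_eq0 => /eqP ->; rewrite lerDr.
- have := rE (0, 0, 1); rewrite /= !sum_zero mulr1 !add0r /r => ?; lra.
Qed.

(** * Lower bounds for the Wasserstein distance *)

Section integrals.
Local Open Scope ereal_scope.

(** The integral of a nonnegative function is a supremum over the simple
    functions below it, so it is monotone without any measurability. It is
    applied to transport costs: measurability of the ground metric for the
    product sigma-field would require separability. *)
Lemma le_integral_nonmeasurable d (T : measurableType d) (R : realType)
    (mu : {measure set T -> \bar R}) (f g : T -> \bar R) :
  (forall x, 0 <= f x) -> (forall x, f x <= g x) ->
  \int[mu]_x f x <= \int[mu]_x g x.
Proof.
move=> f0 fg; rewrite !ge0_integralTE//; last first.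
  by move=> x; exact: le_trans (fg x).
apply: le_ereal_sup => _ [h hf <-]; exists h => // x.
exact: le_trans (hf x) (fg x).
Qed.

Lemma integral_marginal d1 d2 (T1 : measurableType d1) (T2 : measurableType d2)
    (R : realType) (pi : {measure set T1 -> \bar R})
    (nu : {measure set T2 -> \bar R}) (phi : T1 -> T2) (f : T2 -> \bar R) :
  measurable_fun setT phi ->
  (forall A, measurable A -> pushforward pi phi A = nu A) ->
  nu.-integrable setT f ->
  pi.-integrable setT (f \o phi) /\
  \int[pi]_x f (phi x) = \int[nu]_y f y.
Proof.
move=> mphi piE intf; have /integrableP[mf intf'] := intf.
have intE (g : T2 -> \bar R) : \int[pushforward pi phi]_y g y = \int[nu]_y g y.
  by apply: eq_measure_integral => A mA _; exact: piE.
have int_phi : pi.-integrable setT (f \o phi).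
  apply/integrableP; split; first exact: measurableT_comp.
  rewrite -(preimage_setT phi).
  rewrite -(@ge0_integral_pushforward _ _ _ _ _ _ mphi pi _ (abse \o f))//.
  - by rewrite intE.
  - exact: measurableT_comp.
  - by move=> y ?; exact: abse_ge0.
split=> //; rewrite -intE integral_pushforward//.
Qed.

(** Integrating [h y - f x <= c x y] against a coupling only involves its two
    marginals on the left. The positive part appears because the cost may be
    compared with nonnegative functions only. *)
Lemma kantorovich_weak_duality d (T : measurableType d) (R : realType)
    (c : T -> T -> R) (mu nu : {measure set T -> \bar R}) (f h : T -> R) :
  (forall x y, (0 <= c x y)%R) -> (forall x y, (h y - f x <= c x y)%R) ->
  mu.-integrable setT (EFin \o f) -> nu.-integrable setT (EFin \o h) ->
  \int[nu]_y (h y)%:E - \int[mu]_x (f x)%:E <= wasserstein c mu nu.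
Proof.
move=> c0 hfc intf inth; apply/ereal_infP => _ [pi pi_mn <-].
have [intf' fE] := integral_marginal measurable_fst
  (fun A mA => (pi_mn A mA).1) intf.
have [inth' hE] := integral_marginal measurable_snd
  (fun A mA => (pi_mn A mA).2) inth.
rewrite /= in fE hE; rewrite -fE -hE -integralB//.
pose g (u : T * T) : \bar R := (h u.2)%:E - (f u.1)%:E.
have intg : pi.-integrable setT g := integrableB measurableT inth' intf'.
apply: (@le_trans _ _ (\int[pi]_u g^\+ u)).
  apply: le_integral => //; first exact: integrable_funepos.
  by move=> u _; rewrite funeposE le_max lexx.
apply: le_integral_nonmeasurable => u; first by rewrite funepos_ge0.
by rewrite funeposE /g ge_max -EFinB !lee_fin hfc c0.
Qed.

End integrals.

(** * Finitely supported measures *)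

Section discrete.
Local Open Scope ereal_scope.
Context d (T : measurableType d) (R : realType) (J : finType).
Variables (w : J -> R) (w0 : forall j, (0 <= w j)%R) (q : J -> T).

(** Finite sums of measures are indexed by an initial segment of the natural
    numbers; indices beyond the cardinality of [J] get the zero measure. *)
Definition discrete_part (k : nat) : {measure set T -> \bar R} :=
  if (insub k : option 'I_#|J|) is Some i
  then mscale (NngNum (w0 (enum_val i))) \d_(q (enum_val i)) else mzero.

Definition discrete_measure : {measure set T -> \bar R} :=
  msum discrete_part #|J|.

Lemma discrete_measureE A :
  discrete_measure A = (\sum_j w j * \1_A (q j))%:E.
Proof.
rewrite -sumEFin -sum_enum_val /discrete_measure/= /msum; apply: eq_bigr => i _.
by rewrite /discrete_part valK/= /mscale/= diracE -EFinM indicE.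
Qed.

Lemma ge0_integral_discrete (f : T -> \bar R) :
  (forall x, 0 <= f x) -> measurable_fun setT f ->
  \int[discrete_measure]_x f x = \sum_j (w j)%:E * f (q j).
Proof.
move=> f0 mf; rewrite -sum_enum_val ge0_integral_measure_sum//.
apply: eq_bigr => i _; rewrite /discrete_part valK ge0_integral_mscale//.
by rewrite integral_dirac// diracT mul1e.
Qed.

Import HBNNSimple.

(** An inequality suffices for nonmeasurable integrands: every simple function
    below [f] is measurable and is integrated exactly. *)
Lemma integral_discrete_le (f : T -> \bar R) : (forall x, 0 <= f x) ->
  \int[discrete_measure]_x f x <= \sum_j (w j)%:E * f (q j).
Proof.
move=> f0; rewrite ge0_integralTE//; apply: ge_ereal_sup => _ [h hf <-].
rewrite -integralT_nnsfun ge0_integral_discrete//=.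
- by apply: lee_sum => j _; rewrite lee_wpmul2l ?lee_fin.
- by move=> x; rewrite lee_fin; exact: fun_ge0.
- by apply/measurable_EFinP; exact: measurable_funP.
Qed.

Lemma integral_discrete (f : T -> R) : measurable_fun setT f ->
  discrete_measure.-integrable setT (EFin \o f) /\
  \int[discrete_measure]_x (f x)%:E = (\sum_j w j * f (q j))%:E.
Proof.
move=> mf; have mEf : measurable_fun setT (EFin \o f).
  exact/measurable_EFinP.
split.
  apply/integrableP; split=> //.
  rewrite ge0_integral_discrete//; last exact: measurableT_comp.
  by rewrite /= sumEFin ltry.
rewrite integralE.
rewrite ge0_integral_discrete//; last exact: measurable_funepos.
rewrite ge0_integral_discrete//; last exact: measurable_funeneg.
rewrite (eq_bigr (fun j => (w j * Num.max (f (q j)) 0)%:E)); last first.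
  by move=> j _; rewrite funeposE /= -EFin_max -EFinM.
rewrite [X in _ - X](eq_bigr (fun j => (w j * Num.max (- f (q j)) 0)%:E)); last first.
  by move=> j _; rewrite funenegE /= -EFin_max -EFinM.
rewrite !sumEFin -EFinB -sumrB; congr _%:E; apply: eq_bigr => j _.
rewrite -mulrBr; congr (_ * _)%R.
by case: (leP (f (q j)) 0%R) => h; case: (leP (- f (q j))%R 0%R) => h'; lra.
Qed.

Lemma discrete_probability : (\sum_j w j)%R = 1%R ->
  exists P : probability T R, forall A, P A = discrete_measure A.
Proof.
move=> w1; have P1 : discrete_measure setT = 1.
  by rewrite discrete_measureE (eq_bigr w) ?w1// => j _; rewrite indicT mulr1.
pose P : probability T R :=
  HB.pack (msum discrete_part #|J|)
    (Measure_isProbability.Build _ _ _ (msum discrete_part #|J|) P1).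
by exists P.
Qed.

End discrete.

(** * Distance to a set *)

Section distance.
Context {R : realType}.

Lemma dist_to_set_fin {T : metricType R} (x : T) (A : set T) :
  A !=set0 -> dist_to_set x A \is a fin_num.
Proof.
move=> [a Aa]; rewrite fin_numElt; apply/andP; split.
  apply: (@lt_le_trans _ _ 0%E); first exact: ltNyr.
  by apply/ereal_infP => _ [y _ <-]; rewrite lee_fin mdist_ge0.
apply: (@le_lt_trans _ _ (mdist x a)%:E); last exact: ltry.
by apply: ereal_inf_lbound; exists a.
Qed.

Lemma dist_to_set_le {T : metricType R} (x a : T) (A : set T) :
  A a -> fine (dist_to_set x A) <= mdist x a.
Proof.
move=> Aa; rewrite -lee_fin fineK; last by apply: dist_to_set_fin; exists a.
by apply: ereal_inf_lbound; exists a.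
Qed.

Lemma dist_to_set_adherent {T : metricType R} (x : T) (A : set T) (e : R) :
  A !=set0 -> 0 < e ->
  exists2 a, A a & mdist x a < fine (dist_to_set x A) + e.
Proof.
move=> A0 e0.
have [_ [a Aa <-]] := lb_ereal_inf_adherent e0 (dist_to_set_fin x A0).
by rewrite -/(dist_to_set x A) -(fineK (dist_to_set_fin x A0)) lte_fin; exists a.
Qed.

Lemma dist_to_set_lipschitz {T : metricType R} (x y : T) (A : set T) :
  A !=set0 ->
  fine (dist_to_set x A) <= mdist x y + fine (dist_to_set y A).
Proof.
move=> A0; apply/ler_addgt0Pr => e e0.
have [a Aa ya] := dist_to_set_adherent y A0 e0.
apply: (le_trans (dist_to_set_le x Aa)).
by apply: (le_trans (metric_triangle x y a)); lra.
Qed.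

(** The distance is 1-Lipschitz, so its superlevel sets are open, and open sets
    are Borel. *)
Lemma measurable_dist_to_set d (T : polishMetricType R d) (A : set T) :
  A !=set0 -> measurable_fun setT (fun x : T => fine (dist_to_set x A)).
Proof.
move=> A0; apply: (measurability _ (RGenOInfty.measurableE R)).
move=> _ [_ [a ->] <-]; rewrite setTI.
rewrite measurable_borel_subproof; apply: sub_gen_smallest.
rewrite openE => x /=; rewrite in_itv/= andbT => ax.
apply/nbhs_ballP; exists (fine (dist_to_set x A) - a); first by rewrite /= subr_gt0.
move=> y; rewrite -metricType_numDomainType.ball_mdistE /= in_itv/= andbT => xy.
by have := dist_to_set_lipschitz x y A0; lra.
Qed.

End distance.

(** * The transport problem of the conditional chance constraint *)

Lemma integral_empirical d (T : measurableType d) (R : realType) (N : nat)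
    (s : 'I_N -> T) (h : T -> R) : measurable_fun setT h ->
  (empirical (R := R) s).-integrable setT (EFin \o h) /\
  (\int[empirical (R := R) s]_x (h x)%:E)%E =
    (N%:R^-1 * \sum_(i < N) h (s i))%:E.
Proof.
move=> mh.
have w0 (i : 'I_N) : 0 <= N%:R^-1 :> R by rewrite invr_ge0.
have empE A : (empirical (R := R) s A = discrete_measure w0 s A)%E.
  rewrite discrete_measureE /empirical -mulr_sumr EFinM -sumEFin.
  by congr (_ * _)%E; apply: eq_bigr => i _; rewrite diracE indicE.
have [/integrableP[mEh int_h] hE] := integral_discrete w0 s mh.
have intE (g : T -> \bar R) :
    (\int[empirical (R := R) s]_x g x = \int[discrete_measure w0 s]_x g x)%E.
  by apply: eq_measure_integral => A mA _; exact: empE.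
split; first by apply/integrableP; split=> //; rewrite intE.
by rewrite intE hE mulr_sumr.
Qed.

Lemma measurable_fst_preimage d1 d2 (T1 : measurableType d1)
    (T2 : measurableType d2) (A : set T1) :
  measurable A -> measurable (@fst T1 T2 @^-1` A).
Proof.
by move=> mA; rewrite -[X in measurable X]setTI; exact: measurable_fst.
Qed.

Lemma measurable_snd_preimage d1 d2 (T1 : measurableType d1)
    (T2 : measurableType d2) (A : set T2) :
  measurable A -> measurable (@snd T1 T2 @^-1` A).
Proof.
by move=> mA; rewrite -[X in measurable X]setTI; exact: measurable_snd.
Qed.

Lemma cond_prob_le d (T : measurableType d) (R : realType) (P : probability T R)
    (A B : set T) (r : R) : measurable A -> measurable B -> (0 < P B)%E ->
  (cond_prob P A B <= r%:E)%E = (fine (P (A `&` B)) <= r * fine (P B)).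
Proof.
move=> mA mB PB0; rewrite /cond_prob.
rewrite -[P B]fineK ?fin_num_measure// -[P (A `&` B)]fineK; last first.
  by apply: fin_num_measure; exact: measurableI.
have PB : 0 < fine (P B).
  by rewrite fine_gt0// PB0/= ltey_eq fin_num_measure.
by rewrite inver gt_eqF//= lee_pdivrMr// -EFinM lee_fin.
Qed.

Section model.
Context {R : realType} {dX dY : measure_display}.
Context {X : polishMetricType R dX} {Y : polishMetricType R dY}.
Variables (N : nat) (xhat : 'I_N -> X) (yhat : 'I_N -> Y).
Variables (Nb : set X) (F : set Y).
Hypotheses (mNb : measurable Nb) (mF : measurable F).
Hypotheses (Nb0 : Nb !=set0) (NbC0 : ~` Nb !=set0) (F0 : F !=set0).

Local Notation inN := (@fst X Y @^-1` Nb).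
Local Notation inF := (@snd X Y @^-1` F).
Local Notation kbar := (kappa_bar xhat Nb).
Local Notation D := (Delta yhat F).

Let m_inN : measurable inN.
Proof. exact: measurable_fst_preimage. Qed.

Let m_inF : measurable inF.
Proof. exact: measurable_snd_preimage. Qed.

(** Every dual feasible point yields a pair of Kantorovich potentials. On the
    side of [P] the potential is [f], a combination of the indicators of the
    conditioning event and of the failure event. On the side of the samples it
    is [h], which is the cost of leaving the neighborhood minus the smallest
    value of [v i] allowed by the constraints. This value depends on the sample
    point only, so [h] makes sense on the whole space, even when samples
    coincide. That [h p - f u] is below the ground metric is checked for [u]
    outside the neighborhood, inside it but safe, and inside it and failing. *)
Lemma W_to_empirical_ge (P : probability (X * Y)%type R) (t lam : R)
    (v : 'I_N -> R) :
  0 <= t -> (forall i, 0 <= v i) -> (forall i, - kbar i <= v i + lam) ->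
  (forall i, t - (D i + kbar i) <= v i + lam) ->
  ((K0 xhat Nb - N%:R^-1 * \sum_i v i
     - lam * fine (P inN) + t * fine (P (inF `&` inN)))%:E
    <= W_to_empirical xhat yhat P)%E.
Proof.
move=> t0 v0 vb va.
pose kin (p : X * Y) := fine (dist_to_set p.1 Nb).
pose kout (p : X * Y) := fine (dist_to_set p.1 (~` Nb)).
pose De (p : X * Y) := fine (dist_to_set p.2 F).
have mkin : measurable_fun setT kin.
  exact: (measurableT_comp (measurable_dist_to_set Nb0) measurable_fst).
have mkout : measurable_fun setT kout.
  exact: (measurableT_comp (measurable_dist_to_set NbC0) measurable_fst).
have mDe : measurable_fun setT De.
  exact: (measurableT_comp (measurable_dist_to_set F0) measurable_snd).
pose v' p := Num.max 0 (Num.max (kout p - kin p - lam)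
  (t - De p - kin p + kout p - lam)).
pose h p := kout p - v' p.
pose f (u : X * Y) := lam * \1_inN u - t * \1_(inF `&` inN) u.
have mh : measurable_fun setT h.
  apply: measurable_funB => //; apply: measurable_maxr => //.
  apply: measurable_maxr;
    repeat (apply: measurable_funB || apply: measurable_funD) => //.
have [inth hE] := integral_empirical (fun i => (xhat i, yhat i)) mh.
have int1 (A : set (X * Y)) (r : R) : measurable A ->
    P.-integrable setT (fun u => (r * \1_A u)%:E) /\
    (\int[P]_u (r * \1_A u)%:E = (r * fine (P A))%:E)%E.
  move=> mA; have i1 := integrable_indic P mA; split.
    exact: (integrableZl measurableT r i1).
  under eq_integral do rewrite EFinM.
  rewrite integralZl// integral_indic// setIT EFinM fineK//.
  exact: fin_num_measure.
have [i1 e1] := int1 inN lam m_inN.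
have [i2 e2] := int1 (inF `&` inN) t (measurableI _ _ m_inF m_inN).
have intf : P.-integrable setT (EFin \o f) := integrableB measurableT i1 i2.
have fE : (\int[P]_u (f u)%:E = (lam * fine (P inN) -
    t * fine (P (inF `&` inN)))%:E)%E.
  by rewrite EFinB -e1 -e2 -integralB.
have c0 u p : 0 <= @ground_metric R dX dY X Y u p.
  by rewrite /ground_metric addr_ge0// mdist_ge0.
have hfc u p : h p - f u <= ground_metric u p.
  have v'0 : 0 <= v' p by rewrite /v' le_max lexx.
  have v'1 : kout p - kin p - lam <= v' p by rewrite /v' !le_max lexx orbT.
  have v'2 : t - De p - kin p + kout p - lam <= v' p.
    by rewrite /v' !le_max lexx !orbT.
  have dX0 := mdist_ge0 u.1 p.1; have dY0 := mdist_ge0 u.2 p.2.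
  rewrite /h /f /ground_metric !indicE.
  have [uN|uN] := pselect (Nb u.1); last first.
    rewrite !memNset//=; last by case.
    have : kout p <= mdist p.1 u.1 by apply: dist_to_set_le.
    by rewrite metric_sym !mulr0; lra.
  have kinle : kin p <= mdist p.1 u.1 by apply: dist_to_set_le.
  rewrite metric_sym in kinle.
  have [uF|uF] := pselect (F u.2).
    rewrite !mem_set//= !mulr1.
    have : De p <= mdist p.2 u.2 by apply: dist_to_set_le.
    by rewrite metric_sym; lra.
  by rewrite mem_set// memNset//=; [rewrite mulr0 mulr1; lra|case].
apply: le_trans (kantorovich_weak_duality c0 hfc intf inth).
rewrite hE fE -EFinB lee_fin.
have sumh : K0 xhat Nb - N%:R^-1 * \sum_i v i <=
    N%:R^-1 * \sum_i h (xhat i, yhat i).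
  rewrite /K0 -mulrBr -sumrB ler_wpM2l ?invr_ge0//; apply: ler_sum => i _.
  rewrite /h lerD2l lerN2 /v' !ge_max v0/=; apply/andP; split.
    by have := vb i; rewrite /kappa_bar /kappa_in /kappa_out /kin /kout/=; lra.
  have := va i.
  by rewrite /Delta /kappa_bar /kappa_in /kappa_out /kin /kout /De/=; lra.
by lra.
Qed.

(** A plan is realized by moving, for each sample, mass [al i] to a point of
    [Nb `*` F], mass [be i] to a point of [Nb] without changing the outcome, and
    the remaining mass to a point outside [Nb]. The infima defining the costs
    need not be attained, hence the slack [e]. The mass of the failure event is
    only bounded below, because an unchanged outcome may already be a failure. *)
Lemma realize_transport_plan (hN : (0 < N)%N) (al be : 'I_N -> R) (e : R) :
  0 < e -> (forall i, 0 <= al i) -> (forall i, 0 <= be i) ->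
  (forall i, al i + be i <= N%:R^-1) ->
  exists P : probability (X * Y)%type R,
    [/\ (W_to_empirical xhat yhat P <=
          (K0 xhat Nb + \sum_i (al i * (D i + kbar i) + be i * kbar i) + e)%:E)%E,
        P inN = (\sum_i (al i + be i))%:E &
        ((\sum_i al i)%:E <= P (inF `&` inN))%E].
Proof.
move=> e0 al0 be0 abN.
have e20 : 0 < e / 2 by rewrite divr_gt0.
have /choice[xi xiP] : forall i, exists a, Nb a /\
    mdist (xhat i) a < kappa_in xhat Nb i + e / 2.
  by move=> i; have [a] := dist_to_set_adherent (xhat i) Nb0 e20; exists a.
have /choice[xo xoP] : forall i, exists a, ~ Nb a /\
    mdist (xhat i) a < kappa_out xhat Nb i + e / 2.
  by move=> i; have [a] := dist_to_set_adherent (xhat i) NbC0 e20; exists a.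
have /choice[yi yiP] : forall i, exists a, F a /\
    mdist (yhat i) a < D i + e / 2.
  by move=> i; have [a] := dist_to_set_adherent (yhat i) F0 e20; exists a.
pose J := ('I_N + 'I_N + 'I_N)%type.
pose ga i := N%:R^-1 - (al i + be i).
have ga0 i : 0 <= ga i by rewrite subr_ge0.
pose w (j : J) := match j with
  | inl (inl i) => al i | inl (inr i) => be i | inr i => ga i end.
pose idx (j : J) := match j with
  | inl (inl i) => i | inl (inr i) => i | inr i => i end.
pose dest (j : J) : X * Y := match j with
  | inl (inl i) => (xi i, yi i)
  | inl (inr i) => (xi i, yhat i)
  | inr i => (xo i, yhat i) end.
pose src (j : J) : X * Y := (xhat (idx j), yhat (idx j)).
have w0 j : 0 <= w j by case: j => [[i|i]|i] /=.
have sumJ (G : J -> R) : \sum_j G j =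
    \sum_i (G (inl (inl i)) + G (inl (inr i)) + G (inr i)).
  by rewrite !big_sumType/= -!big_split.
have sumN : \sum_(i < N) N%:R^-1 = 1 :> R.
  by rewrite sumr_const card_ord -[_ *+ _]mulr_natr mulVf// pnatr_eq0 -lt0n.
have w1 : \sum_j w j = 1.
  by rewrite sumJ -[RHS]sumN; apply: eq_bigr => i _ /=; rewrite /ga; ring.
have [P PE] := discrete_probability w0 dest w1.
have [pi piE] := discrete_probability w0 (fun j => (dest j, src j)) w1.
have PE' A : P A = (\sum_j w j * \1_A (dest j))%:E.
  by rewrite PE discrete_measureE.
exists P; split.
- apply: (@le_trans _ _ (\int[pi]_u (ground_metric u.1 u.2)%:E)%E).
    apply: ereal_inf_lbound; exists pi => // A mA.
    rewrite /pushforward !piE !discrete_measureE.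
    split; first by rewrite -[RHS]/(P A) PE'.
    rewrite sumJ /= /empirical.
    rewrite (eq_bigr (fun i => (\1_A (xhat i, yhat i))%:E)); last first.
      by move=> i _; rewrite diracE indicE.
    rewrite sumEFin -EFinM mulr_sumr; congr _%:E; apply: eq_bigr => i _ /=.
    rewrite -[\1_(snd @^-1` A) _]/(\1_A (xhat i, yhat i)).
    rewrite -[\1_(snd @^-1` A) (xi i, yhat i, _)]/(\1_A (xhat i, yhat i)).
    rewrite -[\1_(snd @^-1` A) (xo i, yhat i, _)]/(\1_A (xhat i, yhat i)).
    by rewrite /ga; ring.
  have -> : (\int[pi]_u (ground_metric u.1 u.2)%:E = \int[discrete_measure
     w0 (fun j => (dest j, src j))]_u (ground_metric u.1 u.2)%:E)%E.
    by apply: eq_measure_integral => A _ _; exact: piE.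
  apply: le_trans.
    apply: integral_discrete_le => u.
    by rewrite lee_fin addr_ge0// mdist_ge0.
  rewrite sumEFin lee_fin sumJ /=.
  have -> : K0 xhat Nb + \sum_i (al i * (D i + kbar i) + be i * kbar i) + e =
      \sum_i (al i * (kappa_in xhat Nb i + D i + e)
        + be i * (kappa_in xhat Nb i + e) + ga i * (kappa_out xhat Nb i + e)).
    rewrite -[X in _ + X]mulr1 -sumN /K0 !mulr_sumr -!big_split/=.
    by apply: eq_bigr => i _; rewrite /kappa_bar /ga; ring.
  apply: ler_sum => i _; rewrite /ground_metric/=.
  rewrite mdistxx ![mdist _ (xhat i)]metric_sym ![mdist _ (yhat i)]metric_sym.
  have [_ d1] := xiP i; have [_ d2] := xoP i; have [_ d3] := yiP i.
  by rewrite !lerD// ler_wpM2l//; lra.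
- have xiN i y : \1_inN (xi i, y) = 1 :> R.
    by rewrite indicE mem_set//; case: (xiP i).
  have xoN i y : \1_inN (xo i, y) = 0 :> R.
    by rewrite indicE memNset//; case: (xoP i).
  rewrite PE' sumJ; congr _%:E; apply: eq_bigr => i _ /=.
  by rewrite !xiN xoN !mulr1 mulr0 addr0.
- rewrite PE' lee_fin sumJ; apply: ler_sum => i _ /=.
  rewrite [\1_ _ (xi i, yi i)]indicE mem_set/=; last first.
    by split; [have [] := yiP i|have [] := xiP i].
  by rewrite mulr1 -addrA lerDl addr_ge0// mulr_ge0// indicE.
Qed.

(** The feasible set of the linear program only has the weak inequality
    [risk * mass <= failing mass], whereas a violation of the chance constraint
    is strict. A plan that is too cheap is therefore first tilted: the fraction
    [del] of the safe mass is moved to the failure set. As [risk < 1] and the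
    mass is positive, the inequality becomes strict, and the extra cost
    [del * extra] uses at most half of the available [gap]; realizing the tilted
    plan uses a quarter of it. *)
Lemma plans_cost_ge (hN : (0 < N)%N) (theta eps risk : R) :
  0 < eps -> risk < 1 ->
  (worst_case_cond_prob xhat yhat theta eps Nb F <= risk%:E)%E ->
  forall al be : 'I_N -> R, (forall i, 0 <= al i) -> (forall i, 0 <= be i) ->
    (forall i, al i + be i <= N%:R^-1) ->
    eps <= \sum_i (al i + be i) ->
    risk * \sum_i (al i + be i) <= \sum_i al i ->
    theta <= K0 xhat Nb + \sum_i (al i * (D i + kbar i) + be i * kbar i).
Proof.
move=> eps0 risk1 safe al be al0 be0 abN mass_eps risk_al.
set cost := K0 _ _ + _; rewrite leNgt; apply/negP => cheap.
have D0 i : 0 <= D i.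
  apply: fine_ge0; apply/ereal_infP => _ [y _ <-].
  by rewrite lee_fin mdist_ge0.
pose extra := \sum_i be i * D i.
have extra0 : 0 <= extra by apply: sumr_ge0 => i _; rewrite mulr_ge0.
pose gap := theta - cost.
have gap0 : 0 < gap by rewrite subr_gt0.
pose den := 2 * (extra + gap).
have den0 : 0 < den by rewrite /den; lra.
pose del := gap / den.
have del0 : 0 < del by rewrite divr_gt0.
have delE : del * den = gap by rewrite divfK// gt_eqF.
have del1 : del <= 1 by rewrite ler_pdivrMr// mul1r /den; lra.
have del_extra : 2 * (del * extra) <= gap.
  have : 0 <= del * gap by rewrite mulr_ge0 ?ltW.
  by move: delE; rewrite /den; lra.
pose al' i := al i + del * be i; pose be' i := (1 - del) * be i.
have al'0 i : 0 <= al' i by rewrite addr_ge0// mulr_ge0// ltW.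
have be'0 i : 0 <= be' i by rewrite mulr_ge0// subr_ge0.
have abE i : al' i + be' i = al i + be i by rewrite /al' /be'; ring.
have ab'N i : al' i + be' i <= N%:R^-1 by rewrite abE.
have gap4 : 0 < gap / 4 by rewrite divr_gt0.
have [P [WP PN PFN]] := realize_transport_plan hN gap4 al'0 be'0 ab'N.
have massE : \sum_i (al' i + be' i) = \sum_i (al i + be i).
  by apply: eq_bigr => i _.
have costE : \sum_i (al' i * (D i + kbar i) + be' i * kbar i) =
    \sum_i (al i * (D i + kbar i) + be i * kbar i) + del * extra.
  rewrite /extra mulr_sumr -big_split; apply: eq_bigr => i _ /=.
  by rewrite /al' /be'; ring.
have alE : \sum_i al' i = (1 - del) * \sum_i al i
    + del * \sum_i (al i + be i).
  by rewrite !mulr_sumr -big_split; apply: eq_bigr => i _; rewrite /al' /=; ring.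
rewrite massE in PN; rewrite costE addrA -/cost in WP.
have mass0 : 0 < \sum_i (al i + be i) by exact: lt_le_trans mass_eps.
have PF : fine (P (inF `&` inN)) <= risk * fine (P inN).
  rewrite -cond_prob_le//; last by rewrite PN lte_fin.
  apply: le_trans safe; apply: ereal_sup_ubound; exists P => //; split.
    by apply: (le_trans WP); rewrite lee_fin; move: del_extra; rewrite /gap; lra.
  by rewrite /X_marginal /pushforward PN lee_fin.
have : \sum_i al' i <= fine (P (inF `&` inN)).
  rewrite -lee_fin fineK//; apply: fin_num_measure; exact: measurableI.
apply/negP; rewrite -ltNge; apply: (le_lt_trans PF); rewrite PN /= alE.
have h1 : 0 <= (1 - del) * (\sum_i al i - risk * \sum_i (al i + be i)).
  by rewrite mulr_ge0// subr_ge0.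
have h2 : 0 < del * ((1 - risk) * \sum_i (al i + be i)).
  by apply: mulr_gt0 => //; apply: mulr_gt0 => //; rewrite subr_gt0.
by lra.
Qed.

End model.

(** * The equivalence *)

Theorem theorem2 (R : realType) (dX dY : measure_display)
  (X : polishMetricType R dX) (Y : polishMetricType R dY)
  (N : nat) (hN : (0 < N)%N) (xhat : 'I_N -> X) (yhat : 'I_N -> Y)
  (m : nat) (Z : set 'rV[R]_m) (S : 'rV[R]_m -> set Y)
  (x0 : X) (gamma : R) (hgamma : 0 <= gamma)
  (Nb : set X) (hNb : is_neighborhood x0 gamma Nb)
  (eps : R) (heps : 0 < eps <= 1)
  (risk : R) (hrisk : 0 < risk < 1)
  (theta : R) (htheta : 0 < theta)
  (mNb : measurable Nb)
  (hin : forall i : 'I_N, (dist_to_set (xhat i) Nb < +oo)%E)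
  (hout : forall i : 'I_N, (dist_to_set (xhat i) (~` Nb) < +oo)%E)
  (hS : forall z, Z z ->
    [/\ ~` S z !=set0, measurable (~` S z) &
        forall i : 'I_N, (dist_to_set (yhat i) (~` S z) < +oo)%E])
  (hmin : (theta_min xhat yhat eps Nb < theta%:E)%E)
  (z : 'rV[R]_m) (hz : Z z) :
  (worst_case_cond_prob xhat yhat theta eps Nb (~` S z) <= risk%:E)%E <->
  exists (t : R) (v s : 'I_N -> R) (lambda : R),
    [/\ 0 <= t & forall i, 0 <= v i] /\
    [/\ K0 xhat Nb + risk * eps * t - eps * lambda
          - N%:R^-1 * \sum_(i < N) v i >= theta,
        forall i, v i + lambda >= s i,
        forall i, Delta yhat (~` S z) i + kappa_bar xhat Nb i >= t - s i,
        forall i, s i >= - kappa_bar xhat Nb i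
      & lambda <= risk * t].
Proof.
have [F0 mF _] := hS z hz.
have Nb0 : Nb !=set0 by exists x0; case: hNb.
have NbC0 : ~` Nb !=set0.
  have [_ [a NbCa _] _] := ereal_inf_lt (hout (Ordinal hN)).
  by exists a.
have [eps0 _] := andP heps; have [_ risk1] := andP hrisk.
split=> [safe|[t [v [s [lam [[t0 v0] [obj vs ts sk lamt]]]]]]].
- have lp := plans_cost_ge mNb mF Nb0 NbC0 F0 hN eps0 risk1 safe.
  have [t [mu [v [[t0 mu0 v0] [va vb obj]]]]] := transport_lp_duality hN lp.
  (* The multiplier of the mass bound enters through [lambda]: its sign becomes
     the last constraint. *)
  exists t, v, (fun i => v i + (risk * t - mu)), (risk * t - mu).
  split; split=> //.
  + by move: obj; lra.
  + by move=> i; have := va i; lra.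
  + by move=> i; have := vb i; lra.
  + by lra.
- have vb i : - kappa_bar xhat Nb i <= v i + lam by exact: le_trans (vs i).
  have va i : t - (Delta yhat (~` S z) i + kappa_bar xhat Nb i) <= v i + lam.
    by have := ts i; have := vs i; lra.
  have bound P := W_to_empirical_ge mNb mF Nb0 NbC0 F0 P t0 v0 vb va.
  have mN : measurable (@fst X Y @^-1` Nb).
    exact: measurable_fst_preimage.
  have mS : measurable (@snd X Y @^-1` (~` S z)).
    exact: measurable_snd_preimage.
  have PNE (P : probability (X * Y)%type R) : (eps%:E <= X_marginal P Nb)%E ->
      eps <= fine (P (fst @^-1` Nb)).
    by rewrite -lee_fin fineK// fin_num_measure.
  apply: ge_ereal_sup => _ [P [WP epsP] <-].
  rewrite cond_prob_le//; last by apply: lt_le_trans epsP; rewrite lte_fin.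
  have := le_trans (bound P) WP; rewrite lee_fin => boundP.
  rewrite leNgt; apply/negP => viol.
  have lamt0 : 0 <= risk * t - lam by rewrite subr_ge0.
  have [_ [P' epsP' <-] WP'] := ereal_inf_lt hmin.
  have := le_lt_trans (bound P') WP'; rewrite lte_fin => boundP'.
  (* With [t = 0] the lower bound on the distance would be at least [theta]
     for every distribution that gives [Nb] enough mass, against [hmin]. *)
  have tpos : 0 < t.
    rewrite lt_neqAle t0 andbT; apply/eqP => t00.
    have := ler_wpM2l lamt0 (PNE P' epsP').
    by move: boundP' obj; rewrite -t00; lra.
  have := ler_wpM2l lamt0 (PNE P epsP).
  by move: viol; rewrite -(ltr_pM2l tpos); lra.
Qed.
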